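(* Let $I\subseteq[1,\infty)$ be an interval, let $\gamma:I\to(0,\infty)$ be differentiable with derivative $\dot\gamma$, and let $\widehat{\jmath}(y,h)$, $(y,h)\in I\times\mathbb{R}$, be a real function that is sufficiently smooth on $I\times(-\infty,0)$ and on $I\times(0,\infty)$ and satisfies there $$\frac{\partial \widehat{\jmath}}{\partial y}=\frac{1}{2}\frac{\dot\gamma(y)}{y}\left[-\frac{\Theta(h)}{\gamma(y)}+\widehat{\jmath}''-2y\,\frac{h\,\Theta(h)}{\gamma(y)}\,\widehat{\jmath}'+y\,(\widehat{\jmath}')^2\right].$$ Define $F(y,h):=\Theta(h)-\gamma(y)\,\widehat{\jmath}''(y,h)$. Then on each open half-line $h<0$ and $h>0$ (for all $y\in I$), $F$ satisfies $$\frac{\partial F}{\partial y}=\frac{\dot\gamma(y)}{2y}\,F''+\dot\gamma(y)\left(\widehat{\jmath}'-\frac{h\,\Theta(h)}{\gamma(y)}\right)F'+\frac{\dot\gamma(y)}{\gamma(y)}\,F(1-F).$$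
   Context: Primes denote partial derivatives with respect to $h$ and dots denote derivatives with respect to $y$. $\Theta(h)$ is the indicator of the negative half-line: $\Theta(h)=1$ for $h<0$, $\Theta(h)=0$ for $h>0$. ''Sufficiently smooth'' means that $\widehat{\jmath}$ is four times continuously differentiable in $h$ and that $\partial_y\widehat{\jmath}$ and $\partial_y\widehat{\jmath}''$ exist with $\partial_y(\widehat{\jmath}'')=(\partial_y\widehat{\jmath})''$ on each of the two open regions. *)

(* Defs.v *)
From Stdlib Require Import Reals.
From Coquelicot Require Import Coquelicot.
Open Scope R_scope.

Definition is_interval (I : R -> Prop) : Prop :=
  forall a b x, I a -> I b -> a <= x <= b -> I x.

(** Same as [is_derive f x l], except that increments stay in [D]: a one-sided
    derivative at an endpoint of an interval [D], and insensitive to the values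
    of the total function [f] outside [D]. *)
Definition is_derive_within (D : R -> Prop) (f : R -> R) (x l : R) : Prop :=
  filterdiff f (within D (locally x)) (fun t => scal t l).

(** The value at [h = 0] is arbitrary; it is never used, since all equations
    are considered on [h < 0] and on [0 < h]. *)
Definition Theta (h : R) : R := if Rlt_dec h 0 then 1 else 0.

(** Meant for an open set [J]: [Derive_n] is a two-sided derivative. *)
Definition Cn_on (n : nat) (J : R -> Prop) (f : R -> R) : Prop :=
  forall (k : nat) (h : R), (k <= n)%nat -> J h ->
    ex_derive_n f k h /\ continuous (Derive_n f k) h.

Definition sufficiently_smooth (I J : R -> Prop) (j : R -> R -> R) : Prop :=
  (forall y, I y -> Cn_on 4 J (j y)) /\
  exists jy : R -> R -> R,
    forall y h, I y -> J h ->
      is_derive_within I (fun t => j t h) y (jy y h) /\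
      ex_derive_n (jy y) 1 h /\ ex_derive_n (jy y) 2 h /\
      is_derive_within I (fun t => Derive_n (j t) 2 h) y (Derive_n (jy y) 2 h).

Definition Ffun (gamma : R -> R) (j : R -> R -> R) (y h : R) : R :=
  Theta h - gamma y * Derive_n (j y) 2 h.

(* Main.v *)
Require Import Defs.
From Stdlib Require Import Reals Lra Lia Classical ssreflect.
From Coquelicot Require Import Coquelicot.
Open Scope R_scope.

(** On a half-line [J] the indicator is a constant [th] with [th ^ 2 = th].
    Differentiating the equation for [j] twice in [h] and exchanging [d/dy] with
    [d^2/dh^2] gives [d/dy j''] as a polynomial in [j', ..., j'''']; since
    [F' = - gamma j'''] and [F'' = - gamma j''''], the product rule reduces the
    claim to a polynomial identity.  The exchange identifies the [y]-derivative
    provided by smoothness with the one provided by the equation, which is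
    legitimate only when [y] is not isolated in [I]; an isolated point makes
    every derivative claim within [I] hold vacuously. *)

Lemma is_filter_lim_within (D : R -> Prop) (x : R) :
  is_filter_lim (within D (locally x)) x.
Proof. intros P HP. exact (filter_le_within D P HP). Qed.

Lemma within_locally_proper (D : R -> Prop) (x : R) :
  D x -> ProperFilter (within D (locally x)).
Proof.
  intros Dx. split; [|apply within_filter, locally_filter].
  intros P HP. exists x. exact (locally_singleton _ _ HP Dx).
Qed.

Lemma is_derive_within_eps (D : R -> Prop) (f : R -> R) (x l : R) :
  is_derive_within D f x l -> forall eps : posreal,
  locally x (fun t => D t -> Rabs (f t - f x - (t - x) * l) <= eps * Rabs (t - x)).
Proof.
  intros [_ Hf] eps. exact (Hf x (is_filter_lim_within D x) eps).
Qed.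

Definition isolated_in (D : R -> Prop) (x : R) : Prop :=
  locally x (fun t => D t -> t = x).

(** Near [x] the only increment that stays in [D] is zero, so the error estimate reads [0 <= 0]
    whatever [l] is. *)
Lemma is_derive_within_isolated (D : R -> Prop) (f : R -> R) (x l : R) :
  D x -> isolated_in D x -> is_derive_within D f x l.
Proof.
  intros Dx Hx. split; [apply (is_linear_scal_l l)|].
  intros z Hz.
  pose proof (within_locally_proper D x Dx) as PF.
  (* [filterdiff] asks for the estimate at every limit point [z] of the filter; the filter is proper
     because [D x] holds, so its limit is unique and [z] is [x]. *)
  rewrite <- (is_filter_lim_unique (F := within D (locally x)) x z
                (is_filter_lim_within D x) Hz).
  intros eps. apply: (filter_imp _ _ _ Hx). intros t Ht Dt. rewrite (Ht Dt).
  rewrite !minus_eq_zero scal_zero_l minus_eq_zero !norm_zero. lra.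
Qed.

(** If [l1] and [l2] differed, subtracting the two linear approximations would bound
    [Rabs (t - x) * Rabs (l1 - l2)] by a fraction of itself for [t] in [D] near [x]. This forces
    [t = x], so [x] would be isolated. *)
Lemma is_derive_within_unique (D : R -> Prop) (f : R -> R) (x l1 l2 : R) :
  ~ isolated_in D x ->
  is_derive_within D f x l1 -> is_derive_within D f x l2 -> l1 = l2.
Proof.
  intros Hx H1 H2. apply NNPP. intros Hl. apply Hx.
  (* With a quarter for each approximation, the two errors add up to at most half of
     [Rabs (l1 - l2) * Rabs (t - x)]. *)
  assert (He : 0 < Rabs (l1 - l2) / 4)
    by (assert (0 < Rabs (l1 - l2)) by (apply Rabs_pos_lt; lra); lra).
  pose proof (filter_and _ _
    (is_derive_within_eps _ _ _ _ H1 (mkposreal _ He))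
    (is_derive_within_eps _ _ _ _ H2 (mkposreal _ He))) as H.
  apply: (filter_imp _ _ _ H). simpl. intros t [E1 E2] Dt.
  specialize (E1 Dt). specialize (E2 Dt).
  apply NNPP. intros Ht.
  assert (Htx : 0 < Rabs (t - x)) by (apply Rabs_pos_lt; lra).
  pose proof (Rabs_triang (f t - f x - (t - x) * l2)
                (- (f t - f x - (t - x) * l1))) as T.
  rewrite Rabs_Ropp in T.
  replace (f t - f x - (t - x) * l2 + - (f t - f x - (t - x) * l1))
    with ((t - x) * (l1 - l2)) in T by ring.
  rewrite Rabs_mult in T. nra.
Qed.

Lemma is_derive_within_mult (D : R -> Prop) (f g : R -> R) (x lf lg : R) :
  D x -> is_derive_within D f x lf -> is_derive_within D g x lg ->
  is_derive_within D (fun t => f t * g t) x (lf * g x + f x * lg).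
Proof.
  intros Dx Hf Hg. unfold is_derive_within.
  pose proof (within_locally_proper D x Dx) as PF.
  eapply filterdiff_ext_lin.
  - apply (filterdiff_comp_2 (F := within D (locally x)) f g Rmult _ _
             (fun u v => plus (mult u (g x)) (mult (f x) v)) Hf Hg).
    apply (@filterdiff_mult R_AbsRing _ (filtermap_proper_filter _ _ _ _ _) (f x, g x)).
    (* The image of the filter under [t => (f t, g t)] must converge to [(f x, g x)]: this is
       continuity of both factors within [D], itself a consequence of differentiability. *)
    + intros P [eps HP].
      assert (Hlf : filterlim f (within D (locally x)) (locally (f x)))
        by (apply (filterdiff_continuous_aux f (ex_intro (filterdiff f _) _ Hf)), is_filter_lim_within).
      assert (Hlg : filterlim g (within D (locally x)) (locally (g x)))
        by (apply (filterdiff_continuous_aux g (ex_intro (filterdiff g _) _ Hg)), is_filter_lim_within).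
      generalize (Hlf _ (locally_ball (f x) eps)) (Hlg _ (locally_ball (g x) eps)).
      intros Bf Bg. generalize (filter_and (F := within D (locally x)) _ _ Bf Bg).
      apply (filter_imp (F := within D (locally x))).
      intros t Ht. exact (HP (f t, g t) Ht).
    + apply Rmult_comm.
  - intros t. unfold scal, plus, mult; simpl; unfold mult; simpl. ring.
Qed.

Lemma is_derive_within_const_minus (D : R -> Prop) (c : R) (f : R -> R) (x l : R) :
  D x -> is_derive_within D f x l -> is_derive_within D (fun t => c - f t) x (- l).
Proof.
  intros Dx Hf. unfold is_derive_within.
  pose proof (within_locally_proper D x Dx) as PF.
  eapply filterdiff_ext_lin.
  - apply (filterdiff_minus_fct (F := within D (locally x)) (fun _ => c) f _ _
             (filterdiff_const c) Hf).
  - intros t. unfold minus, scal, plus, opp, zero; simpl; unfold mult; simpl. ring.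
Qed.

Lemma Cn_on_is_derive (n k : nat) (J : R -> Prop) (f : R -> R) (h : R) :
  Cn_on n J f -> (k < n)%nat -> J h ->
  is_derive (Derive_n f k) h (Derive_n f (S k) h).
Proof.
  intros Hf Hk Jh. apply Derive_correct. exact (proj1 (Hf (S k) h Hk Jh)).
Qed.

(** Openness makes [Derive f] and [f1] agree on a neighbourhood of [h], not only at [h], so they
    share their derivative there. *)
Lemma is_derive_Derive_open (J : R -> Prop) (f f1 : R -> R) (h l2 : R) :
  open J -> J h ->
  (forall x, J x -> is_derive f x (f1 x)) -> is_derive f1 h l2 ->
  is_derive (Derive f) h l2.
Proof.
  intros HJ Jh H1 H2. apply is_derive_ext_loc with f1; [|exact H2].
  apply: (filter_imp _ _ _ (HJ h Jh)). intros t Jt.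
  symmetry. exact (is_derive_unique _ _ _ (H1 t Jt)).
Qed.

Section HalfLine.

Variables (J : R -> Prop) (th : R).
Hypotheses (HJ : open J) (HTh : forall h, J h -> Theta h = th) (Hth : th * th = th).

Lemma is_derive_Ffun (gamma : R -> R) (j : R -> R -> R) (y h : R) :
  Cn_on 4 J (j y) -> J h ->
  is_derive (Ffun gamma j y) h (- (gamma y * Derive_n (j y) 3 h)).
Proof.
  intros HC Jh.
  apply is_derive_ext_loc with (fun x => th - gamma y * Derive_n (j y) 2 x).
  - apply: (filter_imp _ _ _ (HJ h Jh)). intros t Jt. unfold Ffun. now rewrite HTh.
  - evar_last.
    + apply: is_derive_minus; [apply is_derive_const|].
      apply is_derive_scal, (Cn_on_is_derive 4 2 J); auto; lia.
    + unfold minus, plus, opp, zero; simpl. ring.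
Qed.

Lemma is_derive_Derive_Ffun (gamma : R -> R) (j : R -> R -> R) (y h : R) :
  Cn_on 4 J (j y) -> J h ->
  is_derive (Derive (Ffun gamma j y)) h (- (gamma y * Derive_n (j y) 4 h)).
Proof.
  intros HC Jh.
  apply (is_derive_Derive_open J _ _ _ _ HJ Jh (fun x => is_derive_Ffun gamma j y x HC)).
  apply: is_derive_opp. apply is_derive_scal, (Cn_on_is_derive 4 3 J); auto; lia.
Qed.

(** Here [u] plays the role of the [y]-derivative of [j] at a frozen [y]. Only [h] varies, so [c],
    [y], [g] and [th] are constants and the source term [th / g] drops out. *)
Lemma Derive_n_2_evolution_rhs (c y g : R) (u f : R -> R) (h : R) :
  J h -> Cn_on 4 J f ->
  (forall x, J x -> u x = c * (- (th / g) + Derive_n f 2 x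
     - 2 * y * (x * th / g) * Derive f x + y * (Derive f x) ^ 2)) ->
  Derive_n u 2 h = c * (Derive_n f 4 h
     - 2 * y * (th / g) * (2 * Derive_n f 2 h + h * Derive_n f 3 h)
     + 2 * y * (Derive_n f 2 h ^ 2 + Derive f h * Derive_n f 3 h)).
Proof.
  intros Jh HC Hu.
  assert (D1 : forall x, J x -> is_derive (Derive f) x (Derive_n f 2 x))
    by (intros; apply (Cn_on_is_derive 4 1 J); auto; lia).
  assert (D2 : forall x, J x -> is_derive (Derive_n f 2) x (Derive_n f 3 x))
    by (intros; apply (Cn_on_is_derive 4 2 J); auto; lia).
  assert (D3 : forall x, J x -> is_derive (Derive_n f 3) x (Derive_n f 4 x))
    by (intros; apply (Cn_on_is_derive 4 3 J); auto; lia).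
  revert D1 D2 D3 Hu.
  change (Derive_n u 2 h) with (Derive (Derive u) h).
  (* The iterated derivatives become opaque functions linked only by [D1], [D2], [D3], so that
     [auto_derive] handles them as atoms. *)
  generalize (Derive f) (Derive_n f 2) (Derive_n f 3) (Derive_n f 4).
  intros f1 f2 f3 f4 D1 D2 D3 Hu.
  apply is_derive_unique.
  apply (is_derive_Derive_open J u
    (* The first [h]-derivative of [u] on [J]; the last two terms come from [x * f1 x] and
       [f1 x ^ 2]. *)
    (fun x => c * (f3 x - 2 * y * (th / g) * (f1 x + x * f2 x)
                   + 2 * y * (f1 x * f2 x))) h); auto.
  - intros x Jx.
    apply is_derive_ext_loc with (fun x => c * (- (th / g) + f2 x
     - 2 * y * (x * th / g) * f1 x + y * (f1 x) ^ 2)).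
    + apply: (filter_imp _ _ _ (HJ x Jx)). intros t Jt. now rewrite Hu.
    + auto_derive.
      * repeat split; eexists; auto.
      * rewrite (is_derive_unique _ _ _ (D1 x Jx)) (is_derive_unique _ _ _ (D2 x Jx)).
        unfold Rdiv. ring.
  - auto_derive.
    + repeat split; eexists; auto.
    + rewrite (is_derive_unique _ _ _ (D1 h Jh)) (is_derive_unique _ _ _ (D2 h Jh))
        (is_derive_unique _ _ _ (D3 h Jh)).
      unfold Rdiv. ring.
Qed.

(** Treats both half-lines at once: [th] is 1 on the negative one and 0 on the positive one. *)
Lemma Ffun_equation (I : R -> Prop) (gamma dgamma : R -> R) (j : R -> R -> R) :
  (forall y, I y -> 1 <= y) ->
  (forall y, I y -> 0 < gamma y) ->
  (forall y, I y -> is_derive_within I gamma y (dgamma y)) ->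
  sufficiently_smooth I J j ->
  (forall y h, I y -> J h ->
    is_derive_within I (fun t => j t h) y
      (1 / 2 * (dgamma y / y) *
        (- (Theta h / gamma y) + Derive_n (j y) 2 h
         - 2 * y * (h * Theta h / gamma y) * Derive (j y) h
         + y * (Derive (j y) h) ^ 2))) ->
  forall y h, I y -> J h ->
    ex_derive_n (Ffun gamma j y) 1 h /\
    ex_derive_n (Ffun gamma j y) 2 h /\
    is_derive_within I (fun t => Ffun gamma j t h) y
      (dgamma y / (2 * y) * Derive_n (Ffun gamma j y) 2 h
       + dgamma y * (Derive (j y) h - h * Theta h / gamma y)
           * Derive (Ffun gamma j y) h
       + dgamma y / gamma y * (Ffun gamma j y h * (1 - Ffun gamma j y h))).
Proof.
  intros HI1 Hpos Hgamma [HC [jy Hjy]] Hpde y h Iy Jh.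
  pose proof (is_derive_Ffun gamma j y h (HC y Iy) Jh) as F1.
  pose proof (is_derive_Derive_Ffun gamma j y h (HC y Iy) Jh) as F2.
  split; [eexists; exact F1|]. split; [eexists; exact F2|].
  destruct (classic (isolated_in I y)) as [Hiso|Hiso].
  { now apply is_derive_within_isolated. }
  destruct (Hjy y h Iy Jh) as (_ & _ & _ & Hj2).
  rewrite (Derive_n_2_evolution_rhs (1 / 2 * (dgamma y / y)) y (gamma y) _ (j y)) in Hj2;
    [|exact Jh|exact (HC y Iy)|].
  (* As [y] is not isolated, [jy y x] equals the right-hand side of the equation for every [x] in
     [J], an identity that may be differentiated in [x]. *)
  2: { intros x Jx. rewrite <- (HTh x Jx).
       apply (is_derive_within_unique I (fun t => j t x) y); auto.
       now apply Hjy. }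
  pose proof (is_derive_within_const_minus I (Theta h) _ y _ Iy
    (is_derive_within_mult I gamma _ y _ _ Iy (Hgamma y Iy) Hj2)) as H.
  change (Derive_n (Ffun gamma j y) 2 h) with (Derive (Derive (Ffun gamma j y)) h).
  rewrite (is_derive_unique _ _ _ F1) (is_derive_unique _ _ _ F2).
  unfold Ffun in *. rewrite (HTh h Jh) in H |- *.
  match type of H with is_derive_within _ _ _ ?a =>
  match goal with |- is_derive_within _ _ _ ?b =>
    replace b with a; [exact H|] end end.
  specialize (HI1 y Iy). specialize (Hpos y Iy).
  (* Expanding [F * (1 - F)] isolates [th - th * th], which [Hth] cancels; what remains is an
     identity of rational functions in which [th] is free. *)
  replace (dgamma y / gamma y * ((th - gamma y * Derive_n (j y) 2 h)
             * (1 - (th - gamma y * Derive_n (j y) 2 h))))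
    with (dgamma y / gamma y * (th - th * th + gamma y * Derive_n (j y) 2 h
            * (2 * th - 1 - gamma y * Derive_n (j y) 2 h))) by ring.
  rewrite Hth. field. lra.
Qed.

End HalfLine.

Theorem proposition11
  (I : R -> Prop) (gamma dgamma : R -> R) (j : R -> R -> R)
  (HI : is_interval I)
  (HI1 : forall y, I y -> 1 <= y)
  (Hgamma_pos : forall y, I y -> 0 < gamma y)
  (Hgamma : forall y, I y -> is_derive_within I gamma y (dgamma y))
  (Hsmooth_neg : sufficiently_smooth I (fun h => h < 0) j)
  (Hsmooth_pos : sufficiently_smooth I (fun h => 0 < h) j)
  (Hpde : forall y h, I y -> h < 0 \/ 0 < h ->
    is_derive_within I (fun t => j t h) y
      (1 / 2 * (dgamma y / y) *
        (- (Theta h / gamma y) + Derive_n (j y) 2 h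
         - 2 * y * (h * Theta h / gamma y) * Derive (j y) h
         + y * (Derive (j y) h) ^ 2))) :
  forall y h, I y -> h < 0 \/ 0 < h ->
    ex_derive_n (Ffun gamma j y) 1 h /\
    ex_derive_n (Ffun gamma j y) 2 h /\
    is_derive_within I (fun t => Ffun gamma j t h) y
      (dgamma y / (2 * y) * Derive_n (Ffun gamma j y) 2 h
       + dgamma y * (Derive (j y) h - h * Theta h / gamma y)
           * Derive (Ffun gamma j y) h
       + dgamma y / gamma y * (Ffun gamma j y h * (1 - Ffun gamma j y h))).
Proof.
  intros y h Iy [Hh|Hh].
  - apply (Ffun_equation (fun h => h < 0) 1); auto; try ring.
    + apply open_lt.
    + intros x Hx. unfold Theta. destruct (Rlt_dec x 0); lra.
  - apply (Ffun_equation (fun h => 0 < h) 0); auto; try ring.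
    + apply open_gt.
    + intros x Hx. unfold Theta. destruct (Rlt_dec x 0); lra.
Qed.
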